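(* Let $A$ be a finite set of positive real numbers with $|A|\geq 2$. Then $$\max\{|A+A|,|AA|\}\;\geq\; \frac{|A|^{4/3}}{2\lceil\log_2|A|\rceil^{1/3}}.$$
   Context: For a finite set $A$ of real numbers, the sumset is $A+A=\{a+b : a,b\in A\}$ and the productset is $AA=\{ab : a,b\in A\}$. $|X|$ denotes the cardinality of a finite set $X$, and $\lceil\cdot\rceil$ is the ceiling function. *)

(* Defs.v *)
From HB Require Import structures.
From mathcomp Require Import all_boot all_order all_algebra finmap.
From mathcomp Require Import all_classical all_reals all_analysis.

Set Implicit Arguments.
Unset Strict Implicit.
Unset Printing Implicit Defensive.

Import Order.TTheory GRing.Theory Num.Theory.
Local Open Scope ring_scope.

Definition sumset (R : realType) (A : {fset R}) : {fset R} :=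
  [fset (a + b)%R | a in A, b in A]%fset.

Definition productset (R : realType) (A : {fset R}) : {fset R} :=
  [fset (a * b)%R | a in A, b in A]%fset.

Definition log2 (R : realType) (x : R) : R := ln x / ln 2.

(* Main.v *)
Require Import Defs.
From HB Require Import structures.
From mathcomp Require Import all_boot all_order all_algebra finmap.
From mathcomp Require Import all_classical all_reals all_analysis.
From mathcomp Require Import ring.

Set Implicit Arguments.
Unset Strict Implicit.
Unset Printing Implicit Defensive.

Import Order.TTheory GRing.Theory Num.Theory.
Local Open Scope ring_scope.

(** This is Solymosi's argument.  Write [n = #|A|], [S = A + A], [P = AA], and
let [E] be the multiplicative energy, the number of quadruples in [A] with
[ab = cd].  By Cauchy-Schwarz over the fibres of the product map,
[n ^ 4 <= #|P| * E] ([card_sqr_leq_collisions]).  So an upper bound on [E] in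
terms of the sumset is what is needed.

Rewriting [ab = cd] as an equality of two ratios gives [E = \sum_s r(s) ^ 2],
where [r(s)] is the number of points of the grid [A * A] on the line of slope
[s] through the origin.  Take two lines of slopes [s < t].  The sums of a point
on the first and a point on the second are [r(s) * r(t)] distinct points of
[S * S], because the two directions are independent, and they all lie strictly
between the two lines ([card_below_lt]).  Sectors between consecutive lines are
disjoint, so among [m] slopes with [r(s) >= k] one finds
[(m - 1) * k ^ 2 <= #|S| ^ 2], whence [m * k ^ 2 <= 2 * #|S| ^ 2]
([size_rich_slopes]).

Cutting the range [1 <= r(s) <= n] at the powers of 2, of which
[L = ceil (log2 n)] are relevant, each scale contributes at most
[8 * #|S| ^ 2] to [E] ([card_slope_collisions]).  Thus
[n ^ 4 <= 8 * L * #|P| * #|S| ^ 2] ([card_expn4_leq]), and the theorem is the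
cube root of this inequality. *)

(** * Counting pairs of points with the same image *)

Definition fiber (T : finType) (K : eqType) (f : T -> K) (p : K) : {set T} :=
  [set x | f x == p].

Definition collisions (T : finType) (K : eqType) (f : T -> K) : {set T * T} :=
  [set z | f z.1 == f z.2].

Lemma mem_setX (T U : finType) (X : {set T}) (Y : {set U}) (z : T * U) :
  (z \in finset.setX X Y) = (z.1 \in X) && (z.2 \in Y).
Proof. by case: z => x y; rewrite finset.in_setX. Qed.

Section Collisions.
Variables (T : finType) (K : eqType) (f : T -> K) (D : seq K).
Hypotheses (D_uniq : uniq D) (f_in_D : forall x, f x \in D).

Lemma sum_indicator (q : K) : q \in D -> (\sum_(p <- D) (q == p) = 1)%N.
Proof.
move=> qD; rewrite (bigD1_seq q) //= eqxx big1 // => p.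
by rewrite eq_sym => /negbTE->.
Qed.

Lemma card_fiber_sum (p : K) : (#|fiber f p| = \sum_x (f x == p))%N.
Proof.
rewrite -sum1_card big_mkcond /=; apply: eq_bigr => x _.
by rewrite inE; case: eqP.
Qed.

Lemma sum_card_fiber : (\sum_(p <- D) #|fiber f p| = #|T|)%N.
Proof.
under eq_bigr do rewrite card_fiber_sum.
rewrite exchange_big /= -sum1_card; apply: eq_bigr => x _.
exact: sum_indicator.
Qed.

(** A colliding pair lies in the square of exactly one fibre. *)
Lemma card_collisions :
  (#|collisions f| = \sum_(p <- D) #|fiber f p| ^ 2)%N.
Proof.
transitivity (\sum_(p <- D) #|finset.setX (fiber f p) (fiber f p)|)%N; last first.
  by apply: eq_bigr => p _; rewrite cardsX mulnn.
transitivity (\sum_(p <- D) \sum_(z : T * T)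
    ((f z.1 == p) && (f z.2 == p)))%N; last first.
  apply: eq_bigr => p _; rewrite -sum1_card [RHS]big_mkcond /=.
  by apply: eq_bigr => z _; rewrite mem_setX !inE; case: (_ && _).
rewrite exchange_big /= -sum1_card big_mkcond /=; apply: eq_bigr => z _.
rewrite inE; case: eqP => [e|ne].
  by rewrite -(sum_indicator (f_in_D z.1)) -e; under [RHS]eq_bigr do rewrite andbb.
rewrite big1 // => p _; case: eqP => //= e1; case: eqP => // e2.
by case: ne; rewrite e1.
Qed.

Lemma sum_const_seq (n : nat) : (\sum_(p <- D) n = size D * n)%N.
Proof. by rewrite big_const_seq count_predT iter_addn_0 mulnC. Qed.

(** The Cauchy-Schwarz inequality against the constant 1, obtained by summing
[2uv <= u ^ 2 + v ^ 2] over all pairs of indices. *)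
Lemma sqr_sum_leq (u : K -> nat) :
  ((\sum_(p <- D) u p) ^ 2 <= size D * \sum_(p <- D) u p ^ 2)%N.
Proof.
rewrite -(leq_pmul2l (isT : 0 < 2)%N) -mulnn big_distrl /= big_distrr /=.
have -> : (2 * (size D * \sum_(p <- D) u p ^ 2) =
    \sum_(p <- D) \sum_(q <- D) (u p ^ 2 + u q ^ 2))%N.
  transitivity (\sum_(p <- D) (size D * u p ^ 2 + \sum_(q <- D) u q ^ 2))%N.
    by rewrite big_split /= sum_const_seq -big_distrr /= mul2n addnn.
  by apply: eq_bigr => p _; rewrite big_split /= sum_const_seq.
apply: leq_sum => p _; rewrite big_distrr /= big_distrr /=.
by apply: leq_sum => q _; rewrite nat_Cauchy.
Qed.

(** Cauchy-Schwarz applied to the sizes of the fibres, which sum to [#|T|]. *)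
Lemma card_sqr_leq_collisions : (#|T| ^ 2 <= size D * #|collisions f|)%N.
Proof. by rewrite -sum_card_fiber card_collisions sqr_sum_leq. Qed.

End Collisions.

(** * Lines through the origin in the grid spanned by a set of positive reals *)

Lemma card_fsetM (K : choiceType) (S : {fset K}) :
  (#|` (S `*` S)%fset| = #|` S| ^ 2)%N.
Proof.
have inj : injective (fun z : S * S => (val z.1, val z.2)).
  by move=> [a b] [c d] /= [/val_inj-> /val_inj->].
have -> : (S `*` S = [fset (val z.1, val z.2) | z in {: S * S}])%fset.
  apply/fsetP => -[a b]; rewrite in_fsetM /=; apply/andP/imfsetP => /=.
    by case=> aS bS; exists ([` aS]%fset, [` bS]%fset).
  by case=> -[[x xS] [y yS]] _ /= [-> ->].
by rewrite card_imfset // -cardE card_prod -cardfE mulnn.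
Qed.

Section Slopes.
Variables (R : realType) (A : {fset R}).
Hypothesis A_pos : forall a : R, a \in A -> 0 < a.

Definition slope (z : A * A) : R := val z.2 / val z.1.

(** The part of the grid [S * S], for [S] the sumset, under the line of slope
[s].  Using these nested regions in place of the sectors between consecutive
lines makes the disjointness of the sectors a telescoping sum. *)
Definition below (s : R) : {fset R * R} :=
  [fset p in (sumset A `*` sumset A)%fset | p.2 < s * p.1]%fset.

Lemma val_pos (a : A) : 0 < val a.
Proof. exact/A_pos/valP. Qed.

Lemma slopeP (s : R) (z : A * A) : z \in fiber slope s -> val z.2 = s * val z.1.
Proof. by rewrite inE => /eqP <-; rewrite /slope divfK // gt_eqF ?val_pos. Qed.

Lemma mem_sumset (a b : A) : val a + val b \in sumset A.
Proof. by apply: in_imfset2; apply: valP. Qed.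

(** A point on a line of given slope is determined by its abscissa. *)
Lemma leq_card_fiber_slope (s : R) : (#|fiber slope s| <= #|` A|)%N.
Proof.
rewrite cardfE -(card_in_imset (f := fst)) ?max_card // => x y /slopeP xs /slopeP ys e.
rewrite (surjective_pairing x) (surjective_pairing y) e; congr pair.
by apply: val_inj; rewrite xs ys e.
Qed.

(** For any [a] in [A], the translate [a + A] lies in the sumset. *)
Lemma leq_card_sumset : (#|` A| <= #|` sumset A|)%N.
Proof.
have [->|[a aA]] := fset_0Vmem A; first by rewrite cardfs0.
have -> : #|` A| = #|` [fset (a + b)%R | b in A]%fset|.
  by rewrite card_imfset //; apply: addrI.
apply/fsubset_leq_card/fsubsetP => _ /imfsetP[b /= bA ->].
exact: in_imfset2.
Qed.

(** The vector sums of a point of slope [s] and a point of slope [t] are pairwise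
distinct and have slope strictly between [s] and [t]; so they are points under
the second line that are not under the first one. *)
Lemma card_below_lt (s t : R) : s < t ->
  (#|` below s| + #|fiber slope s| * #|fiber slope t| <= #|` below t|)%N.
Proof.
move=> st.
pose h (z : (A * A) * (A * A)) : R * R :=
  (val z.1.1 + val z.2.1, val z.1.2 + val z.2.2).
pose H := [fset h z | z in finset.setX (fiber slope s) (fiber slope t)]%fset.
have hE z : z \in finset.setX (fiber slope s) (fiber slope t) ->
    h z = (val z.1.1 + val z.2.1, s * val z.1.1 + t * val z.2.1).
  by rewrite mem_setX => /andP[/slopeP zs /slopeP zt]; rewrite /h zs zt.
have <- : #|` H| = (#|fiber slope s| * #|fiber slope t|)%N.
  rewrite card_in_imfset -?cardE ?cardsX //= => x y xX yX.
  rewrite (hE x) // (hE y) //; case=> e1 e2.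
  (* Subtracting s times the first coordinate isolates the point on line t. *)
  have e3 : val x.2.1 = val y.2.1.
    have ts0 : t - s != 0 by rewrite subr_eq0 gt_eqF.
    apply: (mulfI ts0); move: e1 e2 => /=.
    move: (fsval x.1.1) (fsval y.1.1) (fsval x.2.1) (fsval y.2.1) => a b c d e1 e2.
    have -> : (t - s) * c = s * a + t * c - s * (a + c) by ring.
    by rewrite e1 e2; ring.
  have e4 : val x.1.1 = val y.1.1 by move: e1; rewrite e3 => /addIr.
  move: xX yX; rewrite !mem_setX.
  move=> /andP[/slopeP x1 /slopeP x2] /andP[/slopeP y1 /slopeP y2].
  move: x y e3 e4 x1 x2 y1 y2 {hE e1 e2}.
  move=> [[xa xb] [xc xd]] [[ya yb] [yc yd]] /= e3 e4 x1 x2 y1 y2.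
  by congr ((_, _), (_, _)); apply: val_inj => //=; rewrite ?x1 ?x2 ?y1 ?y2 ?e3 ?e4.
have stM (a : A) : s * val a < t * val a by rewrite ltr_pM2r ?val_pos.
have disj : [disjoint below s & H]%fset.
  apply/fdisjointP => p; rewrite !inE => /andP[_ ps]; apply/negP.
  move=> /imfsetP[z /= /hE hz e]; move: ps; rewrite e hz /= mulrDr ltrD2l.
  by rewrite ltNge ltW ?stM.
have := cardfsUI (below s) H; rewrite (eqP disj) cardfs0 addn0 => <-.
apply/fsubset_leq_card/fsubsetP => p; rewrite !inE => /orP[/andP[pS ps]|].
  rewrite pS /=; move: ps => /lt_le_trans; apply; rewrite ler_wpM2r ?(ltW st) //.
  by case/andP: pS => /imfset2P[/= a aA [b bA ->]] _; rewrite addr_ge0 ?ltW ?A_pos.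
move=> /imfsetP[z /= zH ->]; rewrite !mem_sumset /=.
have [/= ->] := hE z zH; rewrite mulrDr ltrD2r.
exact: stM.
Qed.

(** Each step to the next slope adds at least [k ^ 2] points; the induction keeps
the count under the first line so that these increments can be chained. *)
Lemma leq_card_below_path (k : nat) (s : R) (l : seq R) : path <%R s l ->
  (forall t, t \in s :: l -> k <= #|fiber slope t|)%N ->
  (size l * k ^ 2 <= #|` below (last s l)|)%N.
Proof.
suff gen : path <%R s l -> (forall t, t \in s :: l -> k <= #|fiber slope t|)%N ->
    (#|` below s| + size l * k ^ 2 <= #|` below (last s l)|)%N.
  by move=> p r; apply: leq_trans (gen p r); rewrite leq_addl.
elim: l s => [|t l IH] s /=; first by rewrite mul0n addn0.
move=> /andP[st tl] rich.
apply: leq_trans (IH t tl _); last by move=> u ul; rewrite rich // inE ul orbT.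
rewrite mulSn addnA leq_add2r; apply: leq_trans (card_below_lt st).
by rewrite leq_add2l -mulnn leq_mul // rich // !inE eqxx ?orbT.
Qed.

(** [m] lines bound only [m - 1] sectors.  The missing term [k ^ 2] is again at
most [#|A + A| ^ 2], as [k] cannot exceed the size of [A]; this is where the
factor 2 comes from. *)
Lemma size_rich_slopes (k : nat) (D : seq R) : uniq D ->
  (forall s, s \in D -> k <= #|fiber slope s|)%N ->
  (size D * k ^ 2 <= 2 * #|` sumset A| ^ 2)%N.
Proof.
move=> D_uniq rich.
have /permPl := perm_sort <=%R D; have := sort_lt_sorted D; rewrite D_uniq.
case: (sort _ _) => [|s l] /= sl pD.
  by rewrite -(perm_size pD).
have {}rich t : t \in s :: l -> (k <= #|fiber slope t|)%N.
  by rewrite (perm_mem pD); apply: rich.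
have belowS : (#|` below (last s l)| <= #|` sumset A| ^ 2)%N.
  rewrite -card_fsetM; apply: fsubset_leq_card.
  by apply/fsubsetP => p; rewrite !inE => /andP[].
have kS : (k <= #|` sumset A|)%N.
  apply: leq_trans leq_card_sumset; apply: leq_trans (leq_card_fiber_slope s).
  by rewrite rich // mem_head.
rewrite -(perm_size pD) /= mulSn mul2n -addnn leq_add //; first by rewrite leq_sqr.
exact: leq_trans (leq_card_below_path sl rich) belowS.
Qed.

(** If [2 ^ i <= r <= 2 ^ i.+1], the term of index [i] suffices.  The upper end
of the last scale is included, so that [L] scales are enough when [r] is
exactly [2 ^ L]. *)
Lemma sqr_leq_dyadic (r L : nat) : (0 < r)%N -> (0 < L)%N -> (r <= 2 ^ L)%N ->
  (r ^ 2 <= \sum_(i < L) (2 ^ i <= r) * (2 ^ i.+1) ^ 2)%N.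
Proof.
move=> r0; case: L => // L _; elim: L => [|L IH] rL.
  by rewrite big_ord1 /= expn0 r0 mul1n leq_sqr.
rewrite big_ord_recr /=; case: (leqP r (2 ^ L.+1)) => [|lt].
  by move/IH/leq_trans; apply; rewrite leq_addr.
by rewrite (ltnW lt) mul1n (leq_trans _ (leq_addl _ _)) // leq_sqr.
Qed.

(** Scale [i] contributes [(2 ^ i.+1) ^ 2] for each slope with at least [2 ^ i]
points, hence at most 4 times the bound of [size_rich_slopes]. *)
Lemma card_slope_collisions (L : nat) : (0 < L)%N -> (#|` A| <= 2 ^ L)%N ->
  (#|collisions slope| <= 8 * L * #|` sumset A| ^ 2)%N.
Proof.
move=> L0 AL.
pose D := undup (codom slope).
have D_uniq : uniq D := undup_uniq _.
have DT z : slope z \in D by rewrite mem_undup codom_f.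
rewrite (card_collisions D_uniq DT).
apply: (@leq_trans (\sum_(s <- D) \sum_(i < L)
    (2 ^ i <= #|fiber slope s|) * (2 ^ i.+1) ^ 2)%N).
  rewrite !big_seq; apply: leq_sum => s sD; apply: sqr_leq_dyadic => //.
    by move: sD; rewrite mem_undup => /codomP[z ->];
      apply/card_gt0P; exists z; rewrite inE.
  exact: leq_trans (leq_card_fiber_slope s) AL.
rewrite exchange_big /=.
have -> : (8 * L * #|` sumset A| ^ 2 = \sum_(i < L) 8 * #|` sumset A| ^ 2)%N.
  by rewrite sum_nat_const card_ord mulnCA mulnA.
apply: leq_sum => i _.
rewrite -big_distrl /= -(big_mkcond _ (fun=> 1%N)) /= sum1_count -size_filter.
rewrite (expnS 2 i) expnMn mulnCA.
rewrite -[8%N]/(4 * 2)%N -mulnA leq_mul2l /=.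
by apply: size_rich_slopes; rewrite ?filter_uniq // => s; rewrite mem_filter => /andP[].
Qed.

End Slopes.

(** * The sum-product inequality *)

Lemma card_expn4_leq (R : realType) (A : {fset R}) (L : nat) :
  (forall a : R, a \in A -> 0 < a) ->
  (0 < L)%N -> (#|` A| <= 2 ^ L)%N ->
  (#|` A| ^ 4 <= 8 * L * #|` productset A| * #|` sumset A| ^ 2)%N.
Proof.
move=> A_pos L0 AL.
pose mulA (z : A * A) := val z.1 * val z.2.
have mulP z : mulA z \in productset A by apply: in_imfset2; apply: valP.
have -> : (#|` A| ^ 4 = #|{: A * A}| ^ 2)%N by rewrite card_prod -cardfE mulnn -expnM.
apply: leq_trans (card_sqr_leq_collisions (fset_uniq _) mulP) _.
have -> : #|collisions mulA| = #|collisions (@slope R A)|.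
  (* b / a = d / c if and only if b * c = d * a: rearranging a quadruple turns
     a pair of points of equal slope into a pair of equal products. *)
  pose h (z : (A * A) * (A * A)) := ((z.1.2, z.2.1), (z.2.2, z.1.1)).
  pose h' (z : (A * A) * (A * A)) := ((z.2.2, z.1.1), (z.1.2, z.2.1)).
  have hK : cancel h h' by move=> [[a b] [c d]].
  have h'K : cancel h' h by move=> [[a b] [c d]].
  rewrite -(on_card_preimset (f := h) (R := collisions mulA)); last first.
    by apply: onW_bij; exists h'.
  apply: eq_card => -[[a b] [c d]]; rewrite !inE /h /mulA /slope /=.
  by rewrite eqr_div // lt0r_neq0 ?val_pos.
by rewrite mulnAC [leqLHS]mulnC leq_mul2r card_slope_collisions ?orbT.
Qed.

Lemma leq_exp2_ceil_log2 (R : realType) (n : nat) : (1 < n)%N ->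
  exists L : nat, [/\ (0 < L)%N, (n <= 2 ^ L)%N &
    Num.ceil (log2 (n%:R : R)) = L%:Z].
Proof.
move=> n1; have ln2 : 0 < ln (2 : R) by rewrite ln_gt0 // ltr1n.
have c0 : 0 < Num.ceil (log2 (n%:R : R)).
  by rewrite ceil_gt0 /log2 divr_gt0 // ln_gt0 // ltr1n.
have := ceil_ge (log2 (n%:R : R)); case: Num.ceil c0 => // L L0 logL.
exists L; split=> //; rewrite -(ler_nat R) -ler_ln ?posrE ?ltr0n ?expn_gt0 ?(ltnW n1) //.
by rewrite natrX lnXn ?ltr0n // -(mulr_natl (ln 2)) -ler_pdivrMr.
Qed.

Lemma powR_third (R : realType) (x : R) : 0 <= x -> (x ^+ 3) `^ (1 / 3) = x.
Proof. by move=> x0; rewrite -powR_mulrn // -powRrM mul1r divff ?powRr1. Qed.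

Theorem corollary2p2 (R : realType) (A : {fset R})
  (A_pos : forall a : R, a \in A -> 0 < a)
  (A_ge2 : (2 <= #|` A|)%N) :
  (maxn #|` sumset A| #|` productset A|)%:R >=
    (#|` A|%:R : R) `^ (4 / 3) /
      (2 * ((Num.ceil (log2 (#|` A|%:R : R)))%:~R `^ (1 / 3))).
Proof.
have [L [L0 AL ->]] := leq_exp2_ceil_log2 R A_ge2.
have := card_expn4_leq A_pos L0 AL.
set n := #|` A|; set m := maxn _ _ => bound.
have {}bound : (n ^ 4 <= (2 * m) ^ 3 * L)%N.
  apply: leq_trans bound _; rewrite expnMn [leqRHS]mulnAC.
  rewrite -[(2 ^ 3)%N]/8%N -mulnA leq_mul2l /=.
  apply/orP; right; rewrite (expnS m 2); apply: leq_mul; first exact: leq_maxr.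
  by rewrite leq_sqr leq_maxl.
rewrite -[L%:~R]/(L%:R).
have den : 0 < 2 * (L%:R : R) `^ (1 / 3) by rewrite mulr_gt0 // powR_gt0 // ltr0n.
rewrite ler_pdivrMr //.
have -> : m%:R * (2 * (L%:R : R) `^ (1 / 3)) = ((2 * m) ^ 3 * L)%:R `^ (1 / 3).
  rewrite natrM powRM // natrX powR_third // natrM; ring.
have -> : (n%:R : R) `^ (4 / 3) = (n ^ 4)%:R `^ (1 / 3).
  by rewrite natrX -powR_mulrn // -powRrM mulrA mulr1.
by apply: ge0_ler_powR; rewrite ?nnegrE ?ler0n ?ler_nat ?divr_ge0.
Qed.
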